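(* Let $X$ be a finite planar square complex homotopy equivalent to a disk. Suppose that the hyperplanes in $X$ are simple arcs, pairwise intersecting at most twice, and that $X$ is not a single $0$-cell. Then $X$ has a corner or a spur.
   Context: Two edges of a square are parallel if they are disjoint (i.e. opposite in the square); parallelism of arbitrary edges of a square complex $X$ is the transitive closure of this relation. A hyperplane of $X$ is a parallelism class of edges. When $X$ is planar, a hyperplane is also treated as an immersed curve, or as an arc starting and terminating in $\partial X$, formed by the midsegments of squares joining the midpoints of opposite edges in the class; it bisects the squares that contain edges of the class. Intersections of hyperplanes are the intersections of these curves, occurring at centers of squares. A corner of $X$ at a vertex $v$ consists of two consecutive boundary edges intersecting at $v$ which belong to a single square. A spur of $X$ (at $v$) is a $1$-cell with a vertex $v$ that is not contained in any other cell of $X$. *)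

(* Defs.v *)
From mathcomp Require Import all_boot all_algebra.

Set Implicit Arguments.
Unset Strict Implicit.
Unset Printing Implicit Defensive.

(* A finite square complex.  A 1-cell is represented by its two orientations:
   the darts [d] and [rev d].  The attaching map of a square is the closed path
   [side s 0, side s 1, side s 2, side s 3]; the index is taken modulo 4. *)
Record squareComplex := SquareComplex {
  vertex : finType;
  dart : finType;
  square : finType;
  src : dart -> vertex;
  rev : dart -> dart;
  side : square -> 'Z_4 -> dart;
  revK : involutive rev;
  rev_neq : forall d, rev d != d;
  side_closed : forall s i, src (rev (side s i)) = src (side s (i + 1)%R)
}.

Section SquareComplex.
Variable X : squareComplex.
Implicit Types (d : dart X) (s : square X) (H K : {set dart X}).

Definition tgt d : vertex X := src (rev d).

Definition is_side d : bool := [exists s, exists i, side s i == d].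

Definition single_vertex : Prop :=
  [/\ #|vertex X| = 1, #|dart X| = 0 & #|square X| = 0].

(** Homotopy type *)

Fixpoint walk (x y : vertex X) (p : seq (dart X)) : bool :=
  if p is d :: p' then (src d == x) && walk (tgt d) y p' else x == y.

Definition boundary_path s : seq (dart X) := [seq side s i | i <- enum 'Z_4].

(* Homotopy rel endpoints of edge paths from [x] to [y]. *)
Inductive homotopic (x y : vertex X) : seq (dart X) -> seq (dart X) -> Prop :=
| homotopic_refl p : homotopic x y p p
| homotopic_sym p q : homotopic x y p q -> homotopic x y q p
| homotopic_trans p q r :
    homotopic x y p q -> homotopic x y q r -> homotopic x y p r
| homotopic_backtrack p d q :
    walk x y (p ++ [:: d; rev d] ++ q) ->
    homotopic x y (p ++ [:: d; rev d] ++ q) (p ++ q)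
| homotopic_square p s q :
    walk x y (p ++ boundary_path s ++ q) ->
    homotopic x y (p ++ boundary_path s ++ q) (p ++ q).

Definition path_connected : Prop :=
  (exists x : vertex X, True) /\ forall x y, exists p, walk x y p.

Definition simply_connected : Prop :=
  forall x p, walk x x p -> homotopic x x p [::].

(* Coefficient of [d] in the cellular boundary of the 2-chain [c]. *)
Definition boundary (c : square X -> int) d : int :=
  (\sum_s \sum_i c s * ((side s i == d)%:R - (side s i == rev d)%:R))%R.

Definition H2_trivial : Prop :=
  forall c, (forall d, boundary c d = 0%R) -> forall s, c s = 0%R.

(* A 2-dimensional CW complex is homotopy equivalent to a disk (contractible)
   when its homotopy groups vanish; given that it is connected and simply
   connected, this says that its H_2 = pi_2 vanishes. *)
Definition homotopic_to_disk : Prop :=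
  [/\ path_connected, simply_connected & H2_trivial].

(** Hyperplanes *)

Definition parallel1 : rel (dart X) := fun d d' =>
  (d' == rev d) ||
  [exists s, exists i, (d == side s i) && (d' == side s (i + 2%:R)%R)].

Definition parallel : rel (dart X) := connect parallel1.

(* A hyperplane is a class of unoriented edges, hence a set of darts that is
   stable under [rev]. *)
Definition hyperplane H : Prop := exists d, H = [set d' | parallel d d'].

(* The midsegments of [s] are those joining the midpoints of [side s i] and
   [side s (i + 2)], so the pairs [H, K] meet at the center of [s] when one of
   two consecutive sides is in [H] and the other one in [K].  For [H = K] this
   counts the self-intersections of [H]. *)
Definition crossings H K : nat :=
  #|[set s | [exists i, (side s i \in H) && (side s (i + 1)%R \in K)]]|.

(* Crossing a square from its side [d] to the opposite side; the result is
   oriented so as to be a side of the square that is entered next, if any. *)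
Definition cross : rel (dart X) := fun d d' =>
  [exists s, exists i, (d == side s i) && (d' == rev (side s (i + 2%:R)%R))].

(* The curve [H] runs through the midpoints of the edges [a :: p], without
   visiting a midpoint or the center of a square twice, and both its ends are
   on the boundary.  It is a single point if the edge [a] is in no square. *)
Definition simple_arc H : Prop :=
  exists (a : dart X) (p : seq (dart X)),
    [/\ path cross a p,
        ~~ is_side (rev a) && ~~ is_side (last a p),
        H = [set d | (d \in a :: p) || (rev d \in a :: p)],
        uniq ((a :: p) ++ map (@rev X) (a :: p))
      & crossings H H = 0].

Definition spur (v : vertex X) : Prop :=
  exists d, [/\ src d = v,
                forall d', src d' = v -> d' = d \/ d' = rev d
              & forall s i, src (side s i) <> v].

(** Planarity *)

Definition adjacent : rel (dart X) := fun d d' =>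
  (d' == rev d) || (src d' == src d).

(* An embedding in the oriented plane, given by its rotation system: [cw]
   is the clockwise successor of a dart among the darts with the same origin,
   so that [cw (rev d)] follows [d] on the boundary of the region to the left
   of [d].  Attaching maps are read counterclockwise, so that a square lies to
   the left of its sides. *)
Record planeEmbedding := PlaneEmbedding {
  cw : dart X -> dart X;
  cw_inj : injective cw;
  cw_star : forall d d', fconnect cw d d' = (src d == src d');
  (* Every component has genus 0: V + F = E + 2C, isolated vertices excluded *)
  euler : fcard cw predT + fcard (fun d => cw (rev d)) predT
          = fcard (@rev X) predT + 2 * n_comp adjacent predT;
  (* The squares are distinct regions of the complement of the 1-skeleton *)
  side_next : forall s i, cw (rev (side s i)) = side s (i + 1)%R;
  side_inj : injective (fun si : square X * 'Z_4 => side si.1 si.2);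
  (* The unbounded region next to a component is not in X *)
  unbounded : forall d, exists2 d', connect adjacent d d' & ~~ is_side d'
}.

(* [a] and [cw (rev a)] are consecutive edges of the boundary path, which has
   the complement of X to its left; [v] is the vertex between them. *)
Definition corner (E : planeEmbedding) (v : vertex X) : Prop :=
  exists a, let b := cw E (rev a) in
    [/\ src b = v, ~~ is_side a, ~~ is_side b
      & exists s i, side s i = rev b /\ side s (i + 1)%R = rev a].

End SquareComplex.

(* Main.v *)
From Pilot Require (* Makes [rev] the reversal of darts again, rather than [seq.rev]. *)
Import Defs.
From mathcomp Require Import all_boot all_algebra.

(** X is swept from an outer edge [d0]: a subcomplex (Z, S) of edges and squares
   is grown by steps that each add one new vertex, either through an edge whose
   hyperplane misses Z, or through a square two of whose consecutive sides are
   in Z.  The vertex added last is a spur or a corner.  The invariant is that Z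
   meets every hyperplane in a connected arc and has a connected frontier.

   Suppose that no step is possible.  Then the edges leaving Z are crossed by
   continuations of arcs that meet Z, from the right or from the left.  If two
   neighbouring ones were crossed towards each other, the two arcs would cross in
   the square between them; each then enters a region bounded by Z and the
   other one, which it can only leave through a second crossing, and these two
   crossings differ because they lie on opposite sides of the first one: three
   crossings in all.  Hence an edge crossed from its right is followed by another
   such edge, all along the frontier of Z.  But the frontier contains [d0], and no
   arc comes from the exterior.  Regions are handled by winding numbers, which
   exist because X is simply connected. *)

Set Implicit Arguments.
Unset Strict Implicit.
Unset Printing Implicit Defensive.

Import GRing.Theory.
Import Defs.

(** * Crossing squares *)

Section SquareIndices.
Local Open Scope ring_scope.
Implicit Type i : 'Z_4.

Lemma Z4_add11 i : i + 1 + 1 = i + 2%:R.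
Proof. by apply: val_inj; case: i => [[|[|[|[|]]]]]. Qed.

Lemma Z4_add12 i : i + 1 + 2%:R = i + 3%:R.
Proof. by apply: val_inj; case: i => [[|[|[|[|]]]]]. Qed.

Lemma Z4_add21 i : i + 2%:R + 1 = i + 3%:R.
Proof. by apply: val_inj; case: i => [[|[|[|[|]]]]]. Qed.

Lemma Z4_add22 i : i + 2%:R + 2%:R = i.
Proof. by apply: val_inj; case: i => [[|[|[|[|]]]]]. Qed.

Lemma Z4_add31 i : i + 3%:R + 1 = i.
Proof. by apply: val_inj; case: i => [[|[|[|[|]]]]]. Qed.

Lemma Z4_add32 i : i + 3%:R + 2%:R = i + 1.
Proof. by apply: val_inj; case: i => [[|[|[|[|]]]]]. Qed.

Definition Z4_addE := (Z4_add11, Z4_add12, Z4_add21, Z4_add22, Z4_add31, Z4_add32).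

Lemma Z4_cases i j : [\/ j = i, j = i + 1, j = i + 2%:R | j = i + 3%:R].
Proof.
have: [|| j == i, j == i + 1, j == i + 2%:R | j == i + 3%:R].
  by case: i => [[|[|[|[|]]]]] //; case: j => [[|[|[|[|]]]]].
by case/or4P=> /eqP; [apply: Or41|apply: Or42|apply: Or43|apply: Or44].
Qed.

End SquareIndices.

Section Cross.
Local Open Scope ring_scope.
Variables (X : squareComplex) (E : planeEmbedding X).
Implicit Types (d e : dart X) (s : square X) (i : 'Z_4).

(** Since a square lies to the left of its sides, a curve followed along [~>] crosses each dart from
    its right to its left. *)
Local Notation "d ~> e" := (connect (@cross X) d e) (at level 70).

Lemma src_side s i : src (side s (i + 1)) = tgt (side s i).
Proof. by rewrite -side_closed. Qed.

Lemma side_eq s s' i i' : side s i = side s' i' -> s = s' /\ i = i'.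
Proof. by move=> eq_si; case: (@side_inj _ E (s, i) (s', i') eq_si). Qed.

Lemma is_side_side s i : is_side (side s i).
Proof. by apply/existsP; exists s; apply/existsP; exists i. Qed.

Lemma is_sideP d : reflect (exists s i, d = side s i) (is_side d).
Proof.
apply: (iffP existsP) => [[s /existsP[i /eqP <-]]|[s [i ->]]]; first by exists s, i.
by exists s; apply/existsP; exists i.
Qed.

Lemma crossP d e :
  reflect (exists s i, d = side s i /\ e = rev (side s (i + 2%:R))) (cross d e).
Proof.
apply: (iffP existsP) => [[s /existsP[i /andP[/eqP-> /eqP->]]]|[s [i [-> ->]]]].
  by exists s, i.
by exists s; apply/existsP; exists i; rewrite !eqxx.
Qed.

Lemma cross_side s i : cross (side s i) (rev (side s (i + 2%:R))).
Proof. by apply/crossP; exists s, i. Qed.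

Lemma cross_rev d e : cross d e -> cross (rev e) (rev d).
Proof.
case/crossP=> s [i [-> ->]]; apply/crossP; exists s, (i + 2%:R).
by rewrite revK Z4_add22.
Qed.

Lemma cross_fun d e e' : cross d e -> cross d e' -> e = e'.
Proof.
case/crossP=> s [i [-> ->]] /crossP[s' [i' [/side_eq[-> ->] ->]]].
by [].
Qed.

Lemma cross_inj d d' e : cross d e -> cross d' e -> d = d'.
Proof.
move=> /cross_rev de /cross_rev d'e; apply: (can_inj (@revK X)).
exact: cross_fun de d'e.
Qed.

Lemma cross_last d e : d ~> e -> d != e -> exists2 e', d ~> e' & cross e' e.
Proof.
case/connectP=> p; case/lastP: p => [_ ->|p e' path_p ->]; first by rewrite eqxx.
move: path_p; rewrite last_rcons rcons_path => /andP[path_p cr_e] _.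
by exists (last d p) => //; apply/connectP; exists p.
Qed.

Lemma cross_first d e : d ~> e -> d != e -> exists2 d', cross d d' & d' ~> e.
Proof.
case/connectP=> [[_ ->|d' p]]; first by rewrite eqxx.
by case/andP=> cr_d path_p -> _; exists d' => //; apply/connectP; exists p.
Qed.

Lemma connect_cross_rev d e : d ~> e -> rev e ~> rev d.
Proof.
case/connectP=> p; elim: p d => [d _ -> //|d' p IHp d /= /andP[cr_d path_p] def_e].
by apply: connect_trans (IHp _ path_p def_e) (connect1 (cross_rev cr_d)).
Qed.

Lemma parallel_sym d e : parallel d e = parallel e d.
Proof.
apply: sym_connect_sym => {}d {}e.
suff sub d1 d2 : parallel1 d1 d2 -> parallel1 d2 d1 by apply/idP/idP; apply: sub.
case/orP=> [/eqP->|/existsP[s /existsP[i /andP[/eqP-> /eqP->]]]]; apply/orP.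
  by left; rewrite revK.
right; apply/existsP; exists s; apply/existsP; exists (i + 2%:R).
by rewrite Z4_add22 !eqxx.
Qed.

Lemma parallel_refl d : parallel d d.
Proof. exact: connect0. Qed.

Lemma parallel_trans : transitive (@parallel X).
Proof. exact: connect_trans. Qed.

Lemma parallel_rev d : parallel d (rev d).
Proof. by apply: connect1; rewrite /parallel1 eqxx. Qed.

Lemma parallel_opp s i : parallel (side s i) (side s (i + 2%:R)).
Proof.
apply: connect1; apply/orP; right; apply/existsP; exists s.
by apply/existsP; exists i; rewrite !eqxx.
Qed.

Lemma connect_parallel d e : d ~> e -> parallel d e.
Proof.
move: d e; apply: connect_sub => d e /crossP[s [i [-> ->]]].
exact: parallel_trans (parallel_opp s i) (parallel_rev _).
Qed.

(** A chain of parallel edges may go back and forth along a curve. As [cross] is injective, a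
    backward move undoes the last crossing, or else starts the journey from the other orientation of
    [d]; so a directed path remains, up to reversal of its ends. *)
Lemma parallel_cross d e : parallel d e ->
  [\/ d ~> e, d ~> rev e, rev d ~> e | rev d ~> rev e].
Proof.
case/connectP=> p; elim/last_ind: p e => [e _ -> | p e' IHp e]; first exact: Or41.
rewrite rcons_path last_rcons => /andP[path_p par_e] ->{e}.
have {IHp path_p} := IHp _ path_p erefl; move: (last d p) par_e => x.
case/orP=> [/eqP->|/existsP[s /existsP[i /andP[/eqP-> /eqP->]]]].
  by rewrite revK => -[]; [apply: Or42|apply: Or41|apply: Or44|apply: Or43].
have fwd c : c ~> side s i -> c ~> rev (side s (i + 2%:R)).
  by move=> c_si; apply: connect_trans c_si (connect1 (cross_side s i)).
have bwd c : c ~> rev (side s i) ->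
    c ~> side s (i + 2%:R) \/ rev c ~> rev (side s (i + 2%:R)).
  move=> c_si; have [-> | /(cross_last c_si)[c' c_c' cr_c']] := eqVneq c (rev (side s i)).
    by right; rewrite revK; apply: fwd.
  left; suff <- : c' = side s (i + 2%:R) by [].
  by apply: cross_inj cr_c' _; rewrite -{2}(Z4_add22 i); apply: cross_side.
case=> [/fwd|/bwd|/fwd|/bwd]; first exact: Or42.
- by case; [apply: Or41|apply: Or44].
- exact: Or44.
by rewrite revK; case; [apply: Or43|apply: Or42].
Qed.

(** * Consequences of hyperplanes being simple arcs *)

Section SimpleArcs.
Hypothesis Xarcs : forall H : {set dart X}, hyperplane H -> simple_arc H.

(** Otherwise the curve would cross itself at the center of [s]. *)
Lemma parallel_consecutive s i : ~~ parallel (side s i) (side s (i + 1)).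
Proof.
set H := [set e | parallel (side s i) e].
have [|a [p [_ _ _ _ /eqP]]] := Xarcs (H := H); first by exists (side s i).
rewrite cards_eq0 => /eqP cr0; apply/negP=> par_si.
have: s \in (set0 : {set square X}) by rewrite -cr0 inE; apply/existsP; exists i;
  rewrite !inE parallel_refl.
by rewrite inE.
Qed.

(* The list [l] runs along the curve of the hyperplane of [d], from [a] to [z]. *)
Lemma arc_through d : exists l : seq (dart X),
  [/\ d \in l \/ rev d \in l,
      forall e e', cross e e' -> e \in l -> e' \in l /\ index e' l = (index e l).+1,
      forall e e', cross e e' -> e' \in l -> e \in l,
      (exists2 z, (forall e, e \in l -> e ~> z) & ~~ is_side z) /\
      (exists2 a, (forall e, e \in l -> a ~> e) & ~~ is_side (rev a))
    & forall e, e \in l -> rev e \notin l].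
Proof.
have [|a [p [path_p /andP[side_a side_z] defH uniq_l _]]] := Xarcs (H := [set e | parallel d e]).
  by exists d.
have dH: d \in [set e | parallel d e] by rewrite inE parallel_refl.
move: dH uniq_l; rewrite defH inE => /orP d_l; set l := a :: p in d_l *.
rewrite cat_uniq => /and3P[uniq_l disj_l _].
have sorted_l n : (n.+1 < size l)%N -> cross (nth a l n) (nth a l n.+1).
  by move=> lt_n; apply: (pathP a path_p n).
have last_l : last a p = nth a l (size p) by rewrite -[p in size p]/(behead l) nth_last.
exists l; split=> //.
- move=> e e' cr_e l_e.
  (* [e] is a side, whereas the last dart of the arc is not. *)
  have lt_e : ((index e l).+1 < size l)%N.
    rewrite ltn_neqAle index_mem l_e andbT; apply: contra side_z => /eqP[] size_e.
    by rewrite last_l -size_e nth_index //; case/crossP: cr_e => s [i [-> _]];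
      apply: is_side_side.
  have := sorted_l _ lt_e; rewrite nth_index // => /(cross_fun cr_e)->.
  by rewrite mem_nth // index_uniq.
- move=> e e' cr_e l_e'.
  (* Index 0 is impossible: the arc starts on the boundary, so no square precedes its first dart. *)
  case def_n: (index e' l) => [|n].
    case/negP: side_a; have: nth a l (index e' l) = a by rewrite def_n.
    by rewrite nth_index // => <-; case/crossP: cr_e => s [i [_ ->]]; rewrite revK;
      apply: is_side_side.
  have lt_n : (n.+1 < size l)%N by rewrite -def_n index_mem.
  have := sorted_l _ lt_n; rewrite -def_n nth_index // => /(cross_inj cr_e)->.
  by rewrite mem_nth // ltnW.
- split.
    exists (last a p) => // e l_e; case/splitPl: l_e path_p => p1 p2 <-.
    by rewrite cat_path last_cat => /andP[_ path_p2]; apply/connectP; exists p2.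
  exists a => // e l_e; case/splitPl: l_e path_p => p1 p2 <-.
  by rewrite cat_path => /andP[path_p1 _]; apply/connectP; exists p1.
move=> e l_e; apply/negP=> l_re; case/hasP: disj_l; exists e => //.
by rewrite -(revK e) map_f.
Qed.

(** Positions on the arc strictly increase along [~>], and the arc contains no dart together with
    its reverse. If the arc carries [rev d] instead of [d], the journey is read backwards. *)
Lemma cross_no_return d e e' : cross d e -> e ~> e' -> e' != d /\ e' != rev d.
Proof.
have [l [d_l fwd bwd _ norev]] := arc_through d.
have fwds x y : x ~> y -> x \in l -> y \in l /\ (index x l <= index y l)%N.
  case/connectP=> q; elim: q x => [x _ -> //|x' q IHq x /= /andP[cr_x path_q] def_y] l_x.
  have [l_x' def_x'] := fwd _ _ cr_x l_x.
  have [l_y le_y] := IHq _ path_q def_y l_x'.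
  by split=> //; rewrite ltnW // -def_x'.
have noret x y y' : x \in l -> cross x y -> y ~> y' -> y' != x /\ y' != rev x.
  move=> l_x cr_x y_y'; have [l_y def_y] := fwd _ _ cr_x l_x.
  have [l_y' le_y'] := fwds _ _ y_y' l_y.
  split; first by apply: contraTneq le_y' => ->; rewrite def_y ltnn.
  by apply: contraTneq l_y' => ->; apply: norev.
move=> cr_d e_e'; case: d_l => [l_d|l_rd]; first exact: noret cr_d e_e'.
have cr_re := cross_rev cr_d; have re_e' := connect_cross_rev e_e'.
have bwds x y : x ~> y -> y \in l -> x \in l.
  case/connectP=> q; elim: q x => [x _ -> //|x' q IHq x /= /andP[cr_x path_q] def_y] l_y.
  exact: bwd cr_x (IHq _ path_q def_y l_y).
split.
  apply/eqP=> def_e'; rewrite def_e' in re_e'.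
  have [l_re le_re] := fwds _ _ re_e' l_rd; have [_ def_rd] := fwd _ _ cr_re l_re.
  by rewrite def_rd ltnn in le_re.
apply/eqP=> def_e'; rewrite def_e' in e_e'.
have := bwds _ _ (connect_trans (connect1 cr_d) e_e') l_rd.
by move/norev; rewrite l_rd.
Qed.

Lemma cross_end d : exists2 e, d ~> e & ~~ is_side e.
Proof.
have [l [[l_d|l_rd] _ _ [[z to_z side_z] [a from_a side_a]] _]] := arc_through d.
  by exists z => //; apply: to_z.
by exists (rev a) => //; rewrite -[d]revK; apply/connect_cross_rev/from_a.
Qed.

(** A curve that has left [s] cannot enter it again: through the same pair of sides it would return
    to an edge, through the other pair it would cross itself. *)
Lemma square_before s s' i i' : rev (side s (i + 2%:R)) ~> side s' i' -> s <> s'.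
Proof.
move=> con eq_s; rewrite -{}eq_s in con.
have [neq1 neq2] := cross_no_return (cross_side s i) con.
have par : parallel (side s i) (side s i').
  by apply: connect_parallel; apply: connect_trans (connect1 (cross_side s i)) con.
case: (Z4_cases i i') neq1 neq2 con par => ->; rewrite ?eqxx //.
- by move=> _ _ _; rewrite (negPf (parallel_consecutive _ _)).
- move=> _ _ con _; have [eq_e|] := eqVneq (rev (side s (i + 2%:R))) (side s (i + 2%:R)).
    by have := rev_neq (side s (i + 2%:R)); rewrite eq_e eqxx.
  case/(cross_first con) => x cr_x x_e.
  by case: (cross_no_return cr_x x_e) => _; rewrite revK eqxx.
move=> _ _ _; rewrite parallel_sym -{2}[i]Z4_add31.
by rewrite (negPf (parallel_consecutive _ _)).
Qed.

(** * Winding numbers *)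

(** The value of [c] on the region to the left of [d], taken to be 0 if that region is not a square.
    At most one term is nonzero, by [side_inj]. *)
Definition lface (c : square X -> int) d : int :=
  \sum_s \sum_i c s * (side s i == d)%:R.

(** The coefficient of [d] in the 1-chain of the path [p]. *)
Definition net d (p : seq (dart X)) : int :=
  (count_mem d p)%:Z - (count_mem (rev d) p)%:Z.

Lemma lface_side c s i : lface c (side s i) = c s.
Proof.
rewrite /lface (bigD1 s) //= (bigD1 i) //= eqxx mulr1 !big1 ?addr0 // => [s' neq_s|j neq_j].
  by rewrite big1 // => j _; case: eqP => [/side_eq[/eqP]|_]; rewrite ?(negPf neq_s) ?mulr0.
by case: eqP => [/side_eq[_ /eqP]|_]; rewrite ?(negPf neq_j) ?mulr0.
Qed.

Lemma lface_outer c d : ~~ is_side d -> lface c d = 0.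
Proof.
move=> side_d; rewrite /lface big1 // => s _; rewrite big1 // => i _.
by case: eqP side_d => [<-|_]; rewrite ?is_side_side ?mulr0.
Qed.

Lemma boundary_lface c d : boundary c d = lface c d - lface c (rev d).
Proof.
rewrite /boundary /lface -sumrB; apply: eq_bigr => s _.
by rewrite -sumrB; apply: eq_bigr => i _; rewrite mulrBr.
Qed.

Lemma rev_eq d e : (rev d == e) = (d == rev e).
Proof. exact: inv_eq (@revK X) d e. Qed.

Lemma net_cat d p q : net d (p ++ q) = net d p + net d q.
Proof. by rewrite /net !count_cat !PoszD opprD addrACA. Qed.

Lemma net_backtrack d e : net d [:: e; rev e] = 0.
Proof.
rewrite /net /= !addn0 rev_eq (can_eq (@revK X)).
by rewrite addnC subrr.
Qed.

Lemma count_boundary_path d s :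
  (count_mem d (boundary_path s))%:Z = lface (fun s' => (s' == s)%:R) d.
Proof.
rewrite /lface (bigD1 s) //= eqxx [X in _ + X]big1 ?addr0 => [|s' /negPf->]; last first.
  by rewrite big1 // => i _; rewrite mul0r.
rewrite count_map -sum1_count big_enum_cond /= -natz natr_sum big_mkcond /=.
by apply: eq_bigr => i _; rewrite mul1r; case: eqP.
Qed.

(** Each elementary homotopy changes the 1-chain of a path by a boundary: 0 for a backtrack, that of
    one square otherwise. *)
Lemma homotopic_boundary x y p q : homotopic x y p q ->
  exists c, forall d, net d p - net d q = lface c d - lface c (rev d).
Proof.
elim=> {p q} [p|p q _ [c def_c]|p q r _ [c def_c] _ [c' def_c']|p d q _|p s q _].
- exists (fun=> 0) => d; rewrite subrr -boundary_lface /boundary big1 // => s _.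
  by rewrite big1 // => i _; rewrite mul0r.
- exists (fun s => - c s) => d; rewrite -opprB def_c -!boundary_lface -sumrN.
  by apply: eq_bigr => s _; rewrite -sumrN; apply: eq_bigr => i _; rewrite mulNr.
- exists (fun s => c s + c' s) => d; rewrite -[LHS](subrKA (net d q)) def_c def_c'.
  rewrite -!boundary_lface -big_split; apply: eq_bigr => s _.
  by rewrite -big_split; apply: eq_bigr => i _; rewrite mulrDl.
- exists (fun=> 0) => d'; rewrite !net_cat net_backtrack add0r subrr.
  rewrite -boundary_lface /boundary big1 // => s _.
  by rewrite big1 // => i _; rewrite mul0r.
exists (fun s' => (s' == s)%:R) => d.
by rewrite !net_cat addrCA addrK /net !count_boundary_path.
Qed.

Lemma walk_cat (x y z : vertex X) p q : walk x y p -> walk y z q -> walk x z (p ++ q).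
Proof. by elim: p x => [x /eqP->|d p IHp x /= /andP[-> /IHp]]. Qed.

Hypothesis Xsimple : simply_connected X.

(** The 2-chain bounded by the loop gives the winding number of the loop around each square; across
    an edge it jumps by the net number of passages. *)
Lemma winding x p : walk x x p ->
  exists c, forall d, net d p = lface c d - lface c (rev d).
Proof.
move=> /Xsimple/homotopic_boundary[c def_c]; exists c => d.
by rewrite -def_c /net /= !subr0.
Qed.

Lemma net_notin d p : d \notin p -> rev d \notin p -> net d p = 0.
Proof. by move=> p_d p_rd; rewrite /net !(count_memPn _). Qed.

(* Following the curve through [e] until it leaves the complex, the winding
   number can only change at edges of the loop. *)
Lemma winding_ray p c e :
    (forall d, net d p = lface c d - lface c (rev d)) ->
    (forall e1 e', cross e e1 -> e1 ~> e' -> net e' p = 0) ->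
  lface c e = 0.
Proof.
move=> def_c; have [z] := cross_end e; case/connectP=> q.
elim: q e => [e _ -> side_z _|e1 q IHq e /= /andP[cr_e path_q] def_z side_z net0].
  exact: lface_outer.
(* Both darts have the same square on their left. *)
have <- : lface c (rev e1) = lface c e.
  by case/crossP: cr_e => s [i [-> ->]]; rewrite revK !lface_side.
have := def_c e1; rewrite (net0 _ _ cr_e (connect0 _ _)) => /esym/eqP.
rewrite subr_eq0 => /eqP <-; apply: IHq path_q def_z side_z _ => e2 e' cr_e1 e2_e'.
exact: net0 cr_e (connect_trans (connect1 cr_e1) e2_e').
Qed.

(** * Borders of the strip of squares along a curve *)

(** The left border of the strip crossed between [d] and [e]. Recording the square of each edge
    shows which curves can cross the border, and where. *)
Lemma left_rail d e : d ~> e -> exists2 w, walk (src d) (src e) w &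
  forall g, g \in w -> exists s i,
    [/\ d ~> side s i, rev (side s (i + 2%:R)) ~> e & g = rev (side s (i + 3%:R))].
Proof.
case/connectP=> p; elim: p d => [d _ ->|d1 p IHp d /= /andP[cr_d path_p] def_e].
  by exists [::] => //=; rewrite eqxx.
have [w walk_w rail_w] := IHp _ path_p def_e.
have d1_e: d1 ~> e by apply/connectP; exists p.
case/crossP: (cr_d) => s [i [def_d def_d1]].
exists (rev (side s (i + 3%:R)) :: w) => /= [|g].
  rewrite side_closed Z4_addE -def_d eqxx /= /tgt revK.
  by move: walk_w; rewrite def_d1 side_closed Z4_addE.
rewrite inE => /predU1P[->|/rail_w[s' [i' [d1_s s_e ->]]]].
  by exists s, i; rewrite -def_d -def_d1.
by exists s', i'; split=> //; apply: connect_trans (connect1 cr_d) d1_s.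
Qed.

Lemma right_rail d e : d ~> e -> exists2 w, walk (tgt d) (tgt e) w &
  forall g, g \in w -> exists s i,
    [/\ d ~> side s i, rev (side s (i + 2%:R)) ~> e & g = side s (i + 1)].
Proof.
case/connectP=> p; elim: p d => [d _ ->|d1 p IHp d /= /andP[cr_d path_p] def_e].
  by exists [::] => //=; rewrite eqxx.
have [w walk_w rail_w] := IHp _ path_p def_e.
have d1_e: d1 ~> e by apply/connectP; exists p.
case/crossP: (cr_d) => s [i [def_d def_d1]].
exists (side s (i + 1) :: w) => /= [|g].
  rewrite {1}def_d src_side eqxx /=.
  by move: walk_w; rewrite def_d1 /tgt revK side_closed Z4_addE.
rewrite inE => /predU1P[->|/rail_w[s' [i' [d1_s s_e ->]]]].
  by exists s, i; rewrite -def_d -def_d1.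
by exists s', i'; split=> //; apply: connect_trans (connect1 cr_d) d1_s.
Qed.

Lemma parallel_last s i : ~~ parallel (side s i) (side s (i + 3%:R)).
Proof. by rewrite parallel_sym -{2}[i]Z4_add31 parallel_consecutive. Qed.

Lemma cross_parallel_side s i e : rev (side s (i + 2%:R)) ~> e -> parallel (side s i) e.
Proof.
by move=> s_e; apply: connect_parallel;
  apply: connect_trans (connect1 (cross_side s i)) s_e.
Qed.

Lemma parallelW d e f : parallel d e -> parallel e f = parallel d f.
Proof.
move=> par_de; apply/idP/idP; first exact: parallel_trans.
by apply: parallel_trans; rewrite parallel_sym.
Qed.

Lemma parallel_revr d e : parallel d (rev e) = parallel d e.
Proof. by rewrite parallel_sym [RHS]parallel_sym; apply: parallelW;
  apply: parallel_rev. Qed.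

(** A hyperplane separates the ends of its edges. Otherwise its curve would meet the loop [f :: q]
    only at [f], and following it both ways would give winding number 0 on both sides of [f], which
    the loop traverses once. *)
Lemma loop_parallel (f : dart X) q : walk (tgt f) (src f) q ->
  exists2 g, g \in q & parallel f g.
Proof.
move=> walk_q; apply/hasP/negPn/negP => /hasPn q_f.
have [|c def_c] := @winding (src f) (f :: q); first by rewrite /= eqxx.
have net0 e g : parallel f e -> cross e g -> forall h, g ~> h -> e = f \/ e = rev f ->
    net h (f :: q) = 0.
  move=> par_e cr_e h g_h def_e; have [neq1 neq2] := cross_no_return cr_e g_h.
  have par_h : parallel f h.
    apply: parallel_trans par_e (parallel_trans (connect_parallel (connect1 cr_e)) _).
    exact: connect_parallel.
  have [neq_f neq_rf] : h != f /\ rev h != f.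
    by rewrite rev_eq; case: def_e neq1 neq2 => ->; rewrite ?revK.
  apply: net_notin; rewrite inE negb_or ?neq_f ?neq_rf /=.
    by apply: contraL par_h; apply: q_f.
  by apply: contraL par_h => /q_f; rewrite parallel_revr.
have := def_c f; rewrite !(winding_ray def_c) ?subr0.
- rewrite -cat1s net_cat [X in _ + X]net_notin.
  + by rewrite /net /= eqxx eq_sym (negPf (rev_neq f)).
  + by apply: contraL (parallel_refl f); apply: q_f.
  by apply: contraL (parallel_rev f); apply: q_f.
- by move=> e e' cr_e e_e'; apply: net0 (parallel_rev f) cr_e _ e_e' _; right.
by move=> e e' cr_e e_e'; apply: net0 (parallel_refl f) cr_e _ e_e' _; left.
Qed.

(** * Swept subcomplexes *)

Lemma cw_src d : src (cw E d) = src d.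
Proof. by apply/eqP; rewrite eq_sym -(cw_star E) fconnect1. Qed.

Lemma walk_rev u v p : walk u v p -> walk v u [seq rev d | d <- seq.rev p].
Proof.
elim: p u => [u /eqP->|d p IHp u /= /andP[/eqP<- /IHp walk_p]]; first by rewrite /= eqxx.
by rewrite rev_cons map_rcons -cats1; apply: walk_cat walk_p _; rewrite /= /tgt revK !eqxx.
Qed.

(* A dart [x] with origin on [Z] stands for the angle between [x] and [cw E x];
   [turn Z] moves it along the frontier of [Z], with [Z] on the right. *)
Definition turn (Z : {set dart X}) (x : dart X) : dart X :=
  if cw E x \in Z then rev (cw E x) else cw E x.

Lemma turn_in (Z : {set dart X}) x : cw E x \in Z -> turn Z x = rev (cw E x).
Proof. by rewrite /turn => ->. Qed.

Lemma turn_out (Z : {set dart X}) x : cw E x \notin Z -> turn Z x = cw E x.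
Proof. by rewrite /turn => /negPf->. Qed.

(* The frontier condition says that all angles outside [S] along [Z] are met by
   walking around [Z] until one reaches the exterior angle at the end of [d0]. *)
Record swept (d0 : dart X) (Z : {set dart X}) (S : {set square X}) : Prop := Swept {
  swept_base : d0 \in Z;
  swept_rev : forall d, d \in Z -> rev d \in Z;
  swept_side : forall s i, s \in S -> side s i \in Z;
  swept_conn : forall u v, u \in [set src d | d in Z] -> v \in [set src d | d in Z] ->
    exists2 q, walk u v q & {subset q <= Z};
  swept_convex : forall s i d, side s i \in Z -> rev (side s (i + 2%:R)) ~> d -> d \in Z ->
    s \in S;
  swept_boundary : forall x, src x \in [set src d | d in Z] ->
    (forall s i, s \in S -> rev x != side s i) -> fconnect (turn Z) x (rev d0)
}.

(** Rotating clockwise from [x], the first dart of [Z] met is [r]: a competitor can only come right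
    after [r], and then [x] does not start in the angle between the two. That exception serves at
    the new vertex of an added square, where two swept edges meet. *)
Lemma turn_around (Z : {set dart X}) x r : src x = src r -> r \in Z ->
    (forall d, d \in Z -> src d = src r -> d != r -> d = cw E r /\ x != r) ->
  fconnect (turn Z) x (rev r).
Proof.
move=> src_x Z_r uniq_r.
have: fconnect (cw E) (cw E x) r by rewrite (cw_star E) cw_src src_x.
move/iter_findex; move: (findex _ _ _) => n;
  elim: n x src_x uniq_r => [|n IHn] x src_x uniq_r.
  by move=> /= def_r; rewrite -def_r; apply: connect1; rewrite /= /turn def_r Z_r.
have [def_r _|neq_r] := eqVneq (cw E x) r.
  by rewrite -def_r; apply: connect1; rewrite /= /turn def_r Z_r.
have src_cx : src (cw E x) = src r by rewrite cw_src.
have [Z_x|Z'x] := boolP (cw E x \in Z).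
  by case: (uniq_r _ Z_x src_cx neq_r) => /(@cw_inj _ E)->; rewrite eqxx.
rewrite iterSr => /IHn step; apply: connect_trans (step src_cx _).
  by apply: connect1; rewrite /= /turn (negPf Z'x).
by move=> d Z_d src_d /(uniq_r d Z_d src_d)[-> _].
Qed.

Section Swept.
Variables (d0 : dart X) (Z : {set dart X}) (S : {set square X}).
Hypothesis sweptZ : swept d0 Z S.

Lemma swept_revE d : (rev d \in Z) = (d \in Z).
Proof. by apply/idP/idP => /(swept_rev sweptZ); rewrite ?revK. Qed.

(** Convexity puts each square traversed between [d] and [f] in [S], one after the other. *)
Lemma swept_between d e f : d \in Z -> d ~> e -> e ~> f -> f \in Z -> e \in Z.
Proof.
move=> Z_d /connectP[p]; elim: p d Z_d => [d Z_d _ -> //|d1 p IHp d Z_d] /=.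
case/andP=> /crossP[s [i [def_d def_d1]]] path_p def_e e_f Z_f;
  apply: (IHp _ _ path_p def_e e_f Z_f).
rewrite def_d1 swept_revE; apply: (swept_side sweptZ);
  apply: (swept_convex sweptZ (i := i) (d := f)) => //.
  by rewrite -def_d.
by rewrite -def_d1; apply: connect_trans e_f; apply/connectP; exists p.
Qed.

Lemma ray_outside d e f : d \in Z -> d ~> e -> e \notin Z -> e ~> f -> f \notin Z.
Proof. by move=> Z_d d_e Z'e e_f; apply: contra Z'e; apply: swept_between d_e e_f. Qed.

(** * Rays that cross outside the swept subcomplex *)

Hypothesis Xcross : forall H K : {set dart X},
  hyperplane H -> hyperplane K -> H <> K -> (crossings H K <= 2)%N.

(** [crossings] wants the second curve on the side following [i]; if it is known on the preceding
    side, it also passes through the opposite one. *)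
Lemma crossing_mem d e s i j : ~~ parallel d e -> parallel d (side s i) ->
  parallel e (side s j) ->
  s \in [set s | [exists i, (side s i \in [set f | parallel d f]) &&
                            (side s (i + 1) \in [set f | parallel e f])]].
Proof.
move=> de di ej; rewrite inE; apply/existsP; exists i; rewrite !inE di /=.
case: (Z4_cases i j) ej => -> // ej.
- by case/negP: de; rewrite parallel_sym in ej; apply: parallel_trans di ej.
- case/negP: de; apply: parallel_trans di (parallel_trans (parallel_opp _ _) _).
  by rewrite parallel_sym.
by apply: parallel_trans ej _; rewrite -Z4_add32 parallel_opp.
Qed.

(* The two rays crossing at [t] would have to meet again twice: each of them
   enters a region bounded by the other one and [Z], and must leave it. *)
Lemma no_opposed_rays t j e0 e1 : e0 \in Z -> e1 \in Z ->
    e0 ~> side t j -> e1 ~> side t (j + 1) ->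
    side t (j + 2%:R) \notin Z -> side t (j + 3%:R) \notin Z ->
  src (side t (j + 3%:R)) \in [set src d | d in Z] -> False.
Proof.
set e := side t j; set e' := side t (j + 1); set y := side t (j + 3%:R).
move=> Z_e0 Z_e1 e0_e e1_e' Z'z Z'y Z_v; set z := rev (side t (j + 2%:R)).
have Z'z' : z \notin Z by rewrite swept_revE.
have Z'ry : rev y \notin Z by rewrite swept_revE.
have cr_e : cross e z := cross_side t j.
have cr_e' : cross e' (rev y) by rewrite /y -Z4_add12 cross_side.
have e0_z : e0 ~> z := connect_trans e0_e (connect1 cr_e).
have e1_y : e1 ~> rev y := connect_trans e1_e' (connect1 cr_e').
have par_ez : parallel e z := connect_parallel (connect1 cr_e).
have par_ey : parallel e' (rev y) := connect_parallel (connect1 cr_e').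
have Z_src d : d \in Z -> src d \in [set src d | d in Z] by move=> Z_d; apply: imset_f.
(* Otherwise the loop made of the left rail from [e0] to [e], [rev y] and a path in [Z] has winding
   number 0 both at [t] and beyond [y], although it passes [y] once. *)
have [t1 [i1 [t1_e t1_y]]] : exists s i,
    rev (side s (i + 2%:R)) ~> e /\ parallel y (side s (i + 3%:R)).
  have [|no_t1] := boolP [exists s, exists i,
      (rev (side s (i + 2%:R)) ~> e) && parallel y (side s (i + 3%:R))].
    by case/existsP=> s /existsP[i /andP[]]; exists s, i.
  have [w walk_w rail_w] := left_rail e0_e.
  have [q walk_q Zq] := swept_conn sweptZ Z_v (Z_src _ Z_e0).
  have [|c def_c] := @winding (src e0) (w ++ rev y :: q).
    by apply: walk_cat walk_w _; rewrite /= /tgt revK side_closed Z4_addE eqxx.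
  have Z'q f : f \notin Z -> f \notin q by apply: contra; apply: Zq.
  (* Past [t] the curve of [e] stays outside [Z], and neither the rail nor [y] contains an edge of
     its own hyperplane. *)
  have lface_t : lface c e = 0.
    apply: winding_ray def_c _ => f g /(cross_fun cr_e)<- z_g.
    have e_g : parallel e g by apply: parallel_trans par_ez (connect_parallel z_g).
    have notin h : parallel e h -> h \notin Z -> h \notin w ++ rev y :: q.
      move=> e_h Z'h; rewrite mem_cat inE !negb_or Z'q // andbT; apply/andP; split.
        apply: contraTN e_h => /rail_w[s [i [_ s_e ->]]]; rewrite parallel_revr.
        by rewrite (parallelW _ (cross_parallel_side s_e)) parallel_last.
      by apply: contraTneq e_h => ->; rewrite parallel_revr parallel_last.
    have Z'g := ray_outside Z_e0 e0_z Z'z' z_g.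
    by apply: net_notin; apply: notin; rewrite ?parallel_revr ?swept_revE.
  have w_y f : parallel y f -> f \notin w.
    move=> y_f; apply: contra no_t1 => /rail_w[s [i [_ s_e def_f]]].
    by apply/existsP; exists s; apply/existsP; exists i; rewrite s_e -parallel_revr -def_f.
  have net_y : net (rev y) (w ++ rev y :: q) = 1.
    rewrite net_cat [X in X + _]net_notin ?w_y ?revK ?parallel_refl ?parallel_rev // add0r.
    rewrite -cat1s net_cat [X in _ + X]net_notin ?Z'q ?revK // addr0.
    by rewrite /net /= eqxx revK (negPf (rev_neq y)).
  have := def_c (rev y); rewrite net_y revK lface_side -(lface_side c t j) lface_t subr0.
  rewrite (winding_ray def_c) // => f g cr_f f_g;
    have [neq1 neq2] := cross_no_return cr_f f_g.
  have y_g : parallel y g.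
    apply: parallel_trans (parallel_rev y) _; apply: parallel_trans (connect_parallel f_g).
    exact: connect_parallel (connect1 cr_f).
  have Z'g : g \notin Z by apply: (ray_outside Z_e1 e1_y Z'ry); apply: connect_trans f_g;
    apply: connect1.
  apply: net_notin; rewrite mem_cat inE !negb_or w_y ?parallel_revr // Z'q ?swept_revE // andbT //.
  by rewrite (can_eq (@revK X)) -[y]revK.
have [t2 [i2 [j2 [z_t2 t2_e']]]] : exists s i j',
    z ~> side s j' /\ rev (side s (i + 2%:R)) ~> e'.
  have [|no_t2] := boolP [exists s, exists i, exists j',
      (z ~> side s j') && (rev (side s (i + 2%:R)) ~> e')].
    by case/existsP=> s /existsP[i /existsP[j' /andP[]]]; exists s, i, j'.
  have [w walk_w rail_w] := right_rail e1_e'.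
  have Z_tgt : tgt e1 \in [set src d | d in Z] by apply: Z_src; rewrite swept_revE.
  have [q walk_q Zq] := swept_conn sweptZ Z_v Z_tgt.
  have [|c def_c] := @winding (tgt e1) (w ++ rev z :: q).
    apply: walk_cat walk_w _; rewrite /= [rev z]revK -!src_side !Z4_addE eqxx.
    exact: walk_q.
  have Z'q f : f \notin Z -> f \notin q by apply: contra; apply: Zq.
  have lface_t : lface c e' = 0.
    apply: winding_ray def_c _ => f g /(cross_fun cr_e')<- y_g.
    have e_g : parallel e' g by apply: parallel_trans par_ey (connect_parallel y_g).
    have notin h : parallel e' h -> h \notin Z -> h \notin w ++ rev z :: q.
      move=> e_h Z'h; rewrite mem_cat inE !negb_or Z'q // andbT; apply/andP; split.
        apply: contraTN e_h => /rail_w[s [i [_ s_e ->]]].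
        by rewrite (parallelW _ (cross_parallel_side s_e)) parallel_consecutive.
      apply: contraTneq e_h => ->; rewrite revK -Z4_add11; exact: parallel_consecutive.
    have Z'g := ray_outside Z_e1 e1_y Z'ry y_g.
    by apply: net_notin; apply: notin; rewrite ?parallel_revr ?swept_revE.
  have w_z f : z ~> f -> f \notin w.
    move=> z_f; apply: contra no_t2 => /rail_w[s [i [_ s_e def_f]]].
    apply/existsP; exists s; apply/existsP; exists i; apply/existsP; exists (i + 1).
    by rewrite s_e -def_f z_f.
  have w_rz f g : cross f g -> z ~> f -> rev g \notin w.
    case/crossP=> s [i [-> ->]] z_f; rewrite revK.
    apply: contra no_t2 => /rail_w[s' [i' [_ s_e /side_eq[eq_s _]]]].
    apply/existsP; exists s; apply/existsP; exists i'; apply/existsP; exists i.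
    by rewrite z_f eq_s s_e.
  have w_z0 : rev z \notin w.
    apply/negP=> /rail_w[s [i [_ s_e]]]; rewrite revK => /side_eq[eq_s _].
    by case: (square_before s_e).
  have net_z : net z (w ++ rev z :: q) = - 1.
    rewrite net_cat [X in X + _]net_notin ?(w_z z) ?w_z0 ?connect0 // add0r.
    rewrite -cat1s net_cat [X in _ + X]net_notin ?Z'q ?swept_revE // addr0.
    by rewrite /net /= eqxx (negPf (rev_neq z)).
  have := def_c z; rewrite net_z [rev z]revK lface_side -(lface_side c t (j + 1)) lface_t subr0.
  rewrite (winding_ray def_c) // => f g cr_f f_g;
    have [neq1 neq2] := cross_no_return cr_f f_g.
  have z_g : z ~> g by apply: connect_trans f_g; apply: connect1.
  have Z'g : g \notin Z := ray_outside Z_e0 e0_z Z'z' z_g.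
  have [|g' z_g' cr_g'] := cross_last z_g; first by rewrite eq_sym.
  apply: net_notin; rewrite mem_cat inE !negb_or Z'q ?swept_revE // andbT.
    by rewrite w_z.
  by rewrite (w_rz _ _ cr_g' z_g') (can_eq (@revK X)).
have nonpar : ~~ parallel z y.
  by rewrite (parallelW _ par_ez) parallel_last.
(* On the curve of [z] the squares come in the order [t1], [t], [t2], and no square is entered
   twice. *)
have [t1_t tt2] : t1 <> t /\ t <> t2.
  by split; [apply: square_before t1_e | apply: square_before z_t2].
have t1_t2 : t1 <> t2.
  apply: (@square_before t1 t2 i1 j2).
  exact: connect_trans t1_e (connect_trans (connect1 cr_e) z_t2).
have hyp (f : dart X) : hyperplane [set g | parallel f g] by exists f.
have neq_zy : [set g | parallel z g] <> [set g | parallel y g].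
  by move/setP/(_ y); rewrite !inE parallel_refl (negPf nonpar).
have := Xcross (hyp z) (hyp y) neq_zy; rewrite /crossings leqNgt => /negP[].
have /card_uniqP card3 : uniq [:: t1; t; t2].
  by rewrite /= !inE !negb_or !andbT; apply/andP; split; [apply/andP; split|]; apply/eqP.
rewrite -[(2 < _)%N]/(size [:: t1; t; t2] <= _)%N -card3.
apply/subset_leq_card/subsetP=> s; rewrite 2!in_cons mem_seq1 => /or3P[] /eqP->.
- apply: (crossing_mem (i := i1) nonpar _ t1_y).
  by rewrite parallel_sym -(parallelW _ (cross_parallel_side t1_e)).
- apply: (crossing_mem (i := j) (j := j + 3%:R) nonpar); last exact: parallel_refl.
  by rewrite parallel_sym.
apply: (crossing_mem (i := j2) (j := i2) nonpar); first exact: connect_parallel.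
rewrite parallel_sym -(parallelW _ (cross_parallel_side t2_e')).
by rewrite -parallel_revr.
Qed.

Lemma outer_covered z e : e \in Z -> parallel z e ->
  (exists2 e, e \in Z & e ~> z) \/ (exists2 e, e \in Z & e ~> rev z).
Proof.
move=> Z_e; rewrite parallel_sym => /parallel_cross[] e_z;
  [left; exists e|right; exists e|left; exists (rev e)|right; exists (rev e)];
  by rewrite ?swept_revE.
Qed.

Lemma swept_src d : d \in Z -> src d \in [set src d | d in Z].
Proof. by move=> Z_d; apply: imset_f. Qed.

Lemma swept_tgt d : d \in Z -> tgt d \in [set src d | d in Z].
Proof. by move=> Z_d; apply: swept_src; rewrite swept_revE. Qed.

Lemma swept_conn_from (Z' : {set dart X}) u : (forall d, d \in Z' -> rev d \in Z') ->
    (forall d, d \in Z' -> exists2 q, walk u (src d) q & {subset q <= Z'}) ->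
  forall v w, v \in [set src d | d in Z'] -> w \in [set src d | d in Z'] ->
  exists2 q, walk v w q & {subset q <= Z'}.
Proof.
move=> Z'rev Z'conn v w /imsetP[d /Z'conn[p walk_p Z'p] ->]
  /imsetP[e /Z'conn[q walk_q Z'q] ->].
exists ([seq rev d | d <- seq.rev p] ++ q); first exact: walk_cat (walk_rev walk_p) walk_q.
move=> g; rewrite mem_cat => /orP[/mapP[h]|/Z'q//].
by rewrite mem_rev => /Z'p Z'h ->; apply: Z'rev.
Qed.

(** * Growing by an edge or a square *)

Section Spur.
Variable f : dart X.
Hypotheses (Z'f : f \notin Z) (Z_srcf : src f \in [set src d | d in Z]).
Hypothesis f_missed : forall e, e \in Z -> ~~ parallel f e.

(** Otherwise [f] and a path in [Z] form a loop, and [loop_parallel] finds an edge of [Z] in the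
    hyperplane of [f]. *)
Lemma spur_tgt : tgt f \notin [set src d | d in Z].
Proof.
apply/negP=> Z_tgtf; have [q /loop_parallel[g q_g f_g] /(_ g q_g)] :=
  swept_conn sweptZ Z_tgtf Z_srcf.
by move/f_missed/negP.
Qed.

Local Notation Z1 := (f |: (rev f |: Z)).

Lemma swept_spur : swept d0 Z1 S.
Proof.
have tgt_new := spur_tgt.
have mem_Z1 d : d \in Z -> d \in Z1 by move=> Z_d; rewrite !inE Z_d !orbT.
have Z1rev d : d \in Z1 -> rev d \in Z1.
  by rewrite !inE rev_eq (can_eq (@revK X)) swept_revE orbCA.
split=> //; first exact: mem_Z1 (swept_base sweptZ).
- by move=> s i /(swept_side sweptZ i); apply: mem_Z1.
- apply: (swept_conn_from Z1rev) => d; rewrite !inE => /or3P[/eqP->|/eqP->|Z_d].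
  + by exists [::] => //=.
  + exists [:: f]; first by rewrite /= !eqxx.
    by move=> g; rewrite !inE => ->.
  have [q walk_q Zq] := swept_conn sweptZ Z_srcf (swept_src Z_d).
  by exists q => // g /Zq; apply: mem_Z1.
(* The curve of [f] misses [Z] and never returns to [f], so both ends of the arc lie in [Z]. *)
- move=> s i d Z1s s_d Z1d.
  have par_sd : parallel (side s i) d := cross_parallel_side s_d.
  have [neq1 neq2] := cross_no_return (cross_side s i) s_d.
  move: Z1s Z1d; rewrite !inE => /or3P[/eqP def_s|/eqP def_s|Z_s]
    /or3P[/eqP def_d|/eqP def_d|Z_d].
  + by rewrite def_d def_s eqxx in neq1.
  + by rewrite def_d def_s eqxx in neq2.
  + by case/negP: (f_missed Z_d); rewrite -def_s.
  + by rewrite def_d def_s revK eqxx in neq2.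
  + by rewrite def_d def_s eqxx in neq1.
  + case/negP: (f_missed Z_d); apply: parallel_trans (parallel_rev f) _.
    by rewrite -def_s.
  + by case/negP: (f_missed Z_s); rewrite parallel_sym -def_d.
  + by case/negP: (f_missed Z_s); rewrite parallel_sym -parallel_revr -def_d.
  exact: (swept_convex sweptZ) s_d Z_d.
have around x : src x = tgt f -> fconnect (turn Z1) x f.
  move=> src_x; suff: fconnect (turn Z1) x (rev (rev f)) by rewrite revK.
  apply: turn_around => [||d]; [exact: src_x|by rewrite !inE eqxx orbT|].
  rewrite !inE => /or3P[/eqP->|/eqP->|Z_d] src_d; rewrite ?eqxx //.
    by rewrite -[src (rev f)]/(tgt f) in src_d; rewrite -src_d Z_srcf in tgt_new.
  by rewrite -[src (rev f)]/(tgt f) in src_d; rewrite -src_d swept_src in tgt_new.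
(* The frontier walk of [Z] lifts to [Z1]: where it passes [f], a detour goes along [f], around the
   new vertex and back to the angle after [f]. *)
have old x : src x \in [set src d | d in Z] -> fconnect (turn Z) x (rev d0) ->
    fconnect (turn Z1) x (rev d0).
  move=> src_x /iter_findex; move: (findex _ _ _) => n.
  elim: n x src_x => [x _ /= <-|n IHn x src_x]; first exact: connect0.
  rewrite iterSr => iter_x.
  have step1 : fconnect (turn Z1) x (turn Z1 x) by apply: fconnect1.
  have [def_f|neq_f] := eqVneq (cw E x) f.
    apply: connect_trans step1 _; rewrite /turn def_f !inE eqxx /=.
    apply: connect_trans (around _ erefl) _.
    by apply: IHn => //; rewrite -iter_x /turn def_f (negPf Z'f).
  have neq_rf : cw E x != rev f.
    apply: contraNneq tgt_new => def_rf.
    by rewrite -[tgt f]/(src (rev f)) -def_rf cw_src.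
  have eq_turn : turn Z1 x = turn Z x by rewrite /turn !inE (negPf neq_f) (negPf neq_rf).
  rewrite eq_turn in step1; apply: connect_trans step1 _; apply: IHn iter_x.
  rewrite /turn; case: ifP => Z_x; first by apply: swept_tgt.
  by rewrite cw_src.
move=> x src_x side_x; have /imsetP[d Z1d def_x] := src_x.
move: Z1d; rewrite !inE => /or3P[/eqP def_d|/eqP def_d|Z_d]; last first.
- apply: old; first by rewrite def_x swept_src.
  by apply: (swept_boundary sweptZ) => //; rewrite def_x swept_src.
- apply: connect_trans (around x _) _; first by rewrite def_x def_d.
  apply: old => //; apply: (swept_boundary sweptZ) => // s i S_s.
  by apply: contraNneq Z'f => def_f; rewrite -swept_revE def_f (swept_side sweptZ).
apply: old; first by rewrite def_x def_d.
by apply: (swept_boundary sweptZ) => //; rewrite def_x def_d.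
Qed.

Lemma spur_end : Z1 = setT -> spur (tgt f).
Proof.
move=> full; exists (rev f); split=> // [d src_d|s i src_s].
  left; have: d \in Z1 by rewrite full inE.
  rewrite !inE => /or3P[/eqP def_d|/eqP-> //|Z_d].
    by have := spur_tgt; rewrite -src_d def_d Z_srcf.
  by have := spur_tgt; rewrite -src_d swept_src.
have at_tgt d : src d = tgt f -> d = rev f.
  move=> src_d; have: d \in Z1 by rewrite full inE.
  rewrite !inE => /or3P[/eqP def_d|/eqP-> //|Z_d].
    by have := spur_tgt; rewrite -src_d def_d Z_srcf.
  by have := spur_tgt; rewrite -src_d swept_src.
(* The two sides of [s] meeting at this vertex would be the same edge, hence parallel. *)
have def_s := at_tgt _ src_s.
have def_s' : rev (side s (i + 3%:R)) = rev f.
  by apply: at_tgt; rewrite side_closed Z4_addE.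
have := parallel_last s i; rewrite def_s -parallel_revr def_s'.
by rewrite parallel_refl.
Qed.

End Spur.

Section Corner.
Variables (t : square X) (i : 'Z_4).
Hypotheses (S't : t \notin S) (Z_d1 : side t i \in Z) (Z_d2 : side t (i + 1) \in Z).
Hypothesis outer_d0 : ~~ is_side d0.

Local Notation d1 := (side t i).
Local Notation d2 := (side t (i + 1)).
Local Notation d3 := (side t (i + 2%:R)).
Local Notation d4 := (side t (i + 3%:R)).

Lemma corner_d3 : d3 \notin Z.
Proof.
apply: contra S't; rewrite -swept_revE => Z_d3.
exact: (swept_convex sweptZ) Z_d1 (connect0 _ _) Z_d3.
Qed.

Lemma corner_d4 : d4 \notin Z.
Proof.
apply: contra S't; rewrite -swept_revE -Z4_add12 => Z_d4.
exact: (swept_convex sweptZ) Z_d2 (connect0 _ _) Z_d4.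
Qed.

(** Otherwise [d3] and a path in [Z] form a loop. The ray from [d2] through [d4] gives winding
    number 0 at [t], the ray from [d1] gives 0 beyond [d3], yet the loop passes [d3] once. *)
Lemma corner_new : src d4 \notin [set src d | d in Z].
Proof.
apply/negP=> Z_d4.
have Z_src3 : src d3 \in [set src d | d in Z] by rewrite -Z4_add11 src_side swept_tgt.
have [q walk_q Zq] := swept_conn sweptZ Z_d4 Z_src3.
have [|c def_c] := @winding (src d3) (d3 :: q).
  by rewrite /= eqxx -src_side Z4_addE.
have Z'q e : e \notin Z -> e \notin q by apply: contra; apply: Zq.
have cr_d1 : cross d1 (rev d3) := cross_side t i.
have cr_d2 : cross d2 (rev d4) by rewrite -Z4_add12; apply: cross_side.
have lface_t : lface c d2 = 0.
  apply: winding_ray def_c _ => e e' /(cross_fun cr_d2)<- d4_e'.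
  have Z'e' : e' \notin Z.
    by apply: (ray_outside Z_d2 (connect1 cr_d2) _ d4_e'); rewrite swept_revE corner_d4.
  have par_e' : parallel d2 e'.
    exact: parallel_trans (connect_parallel (connect1 cr_d2)) (connect_parallel d4_e').
  have notin e'' : parallel d2 e'' -> e'' \notin Z -> e'' \notin d3 :: q.
    move=> par_e'' Z'e''; rewrite inE negb_or Z'q // andbT.
    by apply: contraTneq par_e'' => ->; rewrite -Z4_add11 parallel_consecutive.
  by apply: net_notin; apply: notin; rewrite ?parallel_revr ?swept_revE.
have net_d3 : net d3 (d3 :: q) = 1.
  rewrite -cat1s net_cat [X in _ + X]net_notin ?Z'q ?swept_revE ?corner_d3 // addr0.
  by rewrite /net /= eqxx eq_sym (negPf (rev_neq d3)).
have := def_c d3; rewrite net_d3 lface_side -(lface_side c t (i + 1)) lface_t sub0r.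
rewrite (winding_ray def_c) // => e e' cr_e e_e'.
have [neq1 neq2] := cross_no_return cr_e e_e'; rewrite revK in neq2.
have Z'e' : e' \notin Z.
  apply: (ray_outside Z_d1 (connect1 cr_d1)); first by rewrite swept_revE corner_d3.
  exact: connect_trans (connect1 cr_e) e_e'.
by apply: net_notin; rewrite inE negb_or Z'q ?swept_revE // andbT // rev_eq.
Qed.

Local Notation Z1 := (d3 |: (rev d3 |: (d4 |: (rev d4 |: Z)))).

Lemma corner_memP d : d \in Z1 ->
  d \in Z \/ exists2 k, side t (k + 2%:R) \in Z & d = side t k \/ d = rev (side t k).
Proof.
rewrite !inE => /or4P[/eqP->|/eqP->|/eqP->|/orP[/eqP->|]]; last by left.
- by right; exists (i + 2%:R); rewrite ?Z4_addE; [|left].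
- by right; exists (i + 2%:R); rewrite ?Z4_addE; [|right].
- by right; exists (i + 3%:R); rewrite ?Z4_addE; [|left].
by right; exists (i + 3%:R); rewrite ?Z4_addE; [|right].
Qed.

(** The new edges are opposite in [t] to edges of [Z], so an arc ending at one of them can be moved
    across [t] to end in [Z]. If it starts at one from outside [t], the same move would put [t] in
    [S]. *)
Lemma corner_convex s j d : side s j \in Z1 -> rev (side s (j + 2%:R)) ~> d -> d \in Z1 ->
  s \in t |: S.
Proof.
move=> Z1s s_d Z1d; rewrite !inE; have [//|neq_st /=] := eqVneq s t.
have [d' Z_d' s_d'] : exists2 d', d' \in Z & rev (side s (j + 2%:R)) ~> d'.
  case: (corner_memP Z1d) => [Z_d|[k Z_k [def_d|def_d]]]; first by exists d.
    exists (rev (side t (k + 2%:R))); first by rewrite swept_revE.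
    by apply: connect_trans s_d _; rewrite def_d; apply/connect1/cross_side.
  have cr_d : cross (side t (k + 2%:R)) d.
    by rewrite def_d -{2}(Z4_add22 k); apply: cross_side.
  have [eq_d|/(cross_last s_d)[x s_x /cross_inj/(_ cr_d)def_x]] :=
    eqVneq (rev (side s (j + 2%:R))) d.
    move: eq_d; rewrite def_d => /(can_inj (@revK X))/side_eq[eq_st _].
    by rewrite eq_st eqxx in neq_st.
  by exists x => //; rewrite def_x.
case: (corner_memP Z1s) => [Z_s|[k Z_k [/side_eq[eq_st _]|def_s]]].
- exact: (swept_convex sweptZ) Z_s s_d' Z_d'.
- by rewrite eq_st eqxx in neq_st.
case/negP: S't; apply: (swept_convex sweptZ) Z_k _ Z_d'; rewrite Z4_add22 -def_s.
exact: connect_trans (connect1 (cross_side s j)) s_d'.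
Qed.

Lemma cw_rev_side s j : cw E (rev (side s j)) = side s (j + 1).
Proof. exact: side_next. Qed.

Lemma corner_rev34 : rev d3 != d4.
Proof.
apply/eqP=> def_d4; have := parallel_consecutive t (i + 2%:R).
by rewrite Z4_addE -def_d4 parallel_rev.
Qed.

Lemma corner_at d : d \in Z1 -> src d = src d4 -> d = rev d3 \/ d = d4.
Proof.
have src2 : src d3 \in [set src d | d in Z] by rewrite -Z4_add11 src_side swept_tgt.
have src4 : src (rev d4) \in [set src d | d in Z] by rewrite side_closed Z4_addE swept_src.
move=> Z1d src_d; have := corner_new; rewrite -src_d => new.
move: Z1d; rewrite !inE => /or4P[/eqP def_d|/eqP|/eqP|/orP[/eqP def_d|/swept_src Z_d]];
  [|by left|by right| |]; case/negP: new; rewrite ?def_d //.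
Qed.

Lemma swept_corner : swept d0 Z1 (t |: S).
Proof.
have new := corner_new.
have src3 : src d3 \in [set src d | d in Z] by rewrite -Z4_add11 src_side swept_tgt.
have src_rd3 : src (rev d3) = src d4 by rewrite side_closed Z4_addE.
have src_rd4 : src (rev d4) = src d1 by rewrite side_closed Z4_addE.
have mem_Z1 d : d \in Z -> d \in Z1 by move=> Z_d; rewrite !inE Z_d !orbT.
have Z1rev d : d \in Z1 -> rev d \in Z1.
  rewrite !inE !rev_eq !revK swept_revE.
  by case/or4P=> [->|->|->|/orP[]->]; rewrite ?orbT.
have Z1d3 : d3 \in Z1 by rewrite !inE eqxx.
have Z1d4 : d4 \in Z1 by rewrite !inE eqxx !orbT.
split=> //; first exact: mem_Z1 (swept_base sweptZ).
- move=> s j; rewrite in_setU1 => /predU1P[->|/(swept_side sweptZ j)]; last exact: mem_Z1.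
  by case: (Z4_cases i j) => -> //; apply: mem_Z1.
- have to_Z u : u \in [set src d | d in Z] ->
  exists2 q, walk (src d3) u q & {subset q <= Z1}.
    by move=> /(swept_conn sweptZ src3)[q walk_q Zq]; exists q => // g /Zq; apply: mem_Z1.
  have to_new : exists2 q, walk (src d3) (src d4) q & {subset q <= Z1}.
    exists [:: d3]; first by rewrite /= eqxx /tgt src_rd3 eqxx.
    by move=> g; rewrite inE => /eqP->.
  apply: (swept_conn_from Z1rev) => d.
  rewrite !inE => /or4P[/eqP->|/eqP->|/eqP->|/orP[/eqP->|/swept_src]].
  + exact: to_Z.
  + by rewrite src_rd3.
  + exact: to_new.
  + by rewrite src_rd4; apply/to_Z/swept_src.
  exact: to_Z.
- exact: corner_convex.
(* At the new vertex the angle of [rev d3] is the one inside [t]; from every other angle the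
   frontier leaves along [d3]. *)
have around x : src x = src d4 -> x != rev d3 -> fconnect (turn Z1) x d3.
  move=> src_x neq_x; suff: fconnect (turn Z1) x (rev (rev d3)) by rewrite revK.
  apply: turn_around => [||d Z1d];
    [by rewrite src_rd3|exact: Z1rev|rewrite src_rd3 => src_d].
  by case: (corner_at Z1d src_d) => ->; rewrite ?eqxx // cw_rev_side Z4_addE.
(* The three angles of [t] at vertices of [Z]. The frontier of [Z] goes through them in this order
   and continues at [d3]; they are interior once [t] is added. *)
pose T := [:: rev d4; rev d1; rev d2].
have cw_rd4 : cw E (rev d4) = d1 by rewrite cw_rev_side Z4_addE.
have cw_rd1 : cw E (rev d1) = d2 by rewrite cw_rev_side.
have cw_rd2 : cw E (rev d2) = d3 by rewrite cw_rev_side Z4_addE.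
have Z'd3 := corner_d3; have Z'd4 := corner_d4.
have T'd3 : d3 \notin T.
  rewrite !inE !negb_or -rev_eq corner_rev34 /=.
  by apply/andP; split; apply: contraNneq Z'd3 => ->; rewrite swept_revE.
(* The frontier walk of [Z] lifts to [Z1] once each position in [T] is replaced by [d3], the
   position that follows them. *)
have old n x : src x \in [set src d | d in Z] -> iter n (turn Z) x = rev d0 ->
    fconnect (turn Z1) (if x \in T then d3 else x) (rev d0).
  elim: n x => [|n IHn] x src_x.
    suff T'd0 : rev d0 \notin T by move=> /= ->; rewrite (negPf T'd0) connect0.
    by apply: contra outer_d0; rewrite !inE !(can_eq (@revK X)) => /or3P[]/eqP->;
      apply: is_side_side.
  rewrite iterSr => iter_x.
  have src_turn : src (turn Z x) \in [set src d | d in Z].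
    by rewrite /turn; case: ifP => Z_x; [apply: swept_tgt|rewrite cw_src].
  have {IHn} := IHn _ src_turn iter_x; rewrite {iter_x}.
  have [|T'x] := boolP (x \in T).
    rewrite inE => /predU1P[->|]; first by rewrite turn_in cw_rd4 // !inE eqxx orbT.
    rewrite inE => /predU1P[->|]; first by rewrite turn_in cw_rd1 // !inE eqxx !orbT.
    by rewrite inE => /eqP->; rewrite turn_out cw_rd2 // (negPf T'd3).
  have step1 : fconnect (turn Z1) x (turn Z1 x) by apply: fconnect1.
  (* Here the old walk enters [T]; the new one goes along [d4] to the new vertex and around it to
     [d3]. *)
  have [def_x|neq_rd4] := eqVneq (cw E x) (rev d4).
    rewrite turn_out def_x ?swept_revE // mem_head.
    apply: connect_trans; apply: connect_trans step1 _.
    rewrite turn_in def_x ?Z1rev // revK; apply: around => //.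
    by rewrite eq_sym corner_rev34.
  have neq_d3 : cw E x != d3.
    by apply: contraNneq T'x; rewrite -cw_rd2 => /(@cw_inj _ E)->; rewrite !inE eqxx !orbT.
  have neq_new d : src d = src d4 -> cw E x != d.
    by move=> src_d; apply: contraNneq new => def_d; rewrite -src_d -def_d cw_src.
  have eq_turn : turn Z1 x = turn Z x.
    by rewrite /turn !inE (negPf neq_d3) (negPf neq_rd4) !(negPf (neq_new _ _)).
  rewrite eq_turn in step1; suff /negPf-> : turn Z x \notin T by apply: connect_trans.
  rewrite /turn; case: ifP => Z_x; rewrite !inE ?(can_eq (@revK X)) !negb_or.
    rewrite neq_new //= -cw_rd4 -cw_rd1 !(inj_eq (@cw_inj _ E)).
    by move: T'x; rewrite !inE !negb_or => /and3P[-> ->].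
  rewrite neq_rd4 /=; apply/andP.
  by split; apply: contraFneq Z_x => ->; rewrite swept_revE.
move=> x src_x side_x; have /imsetP[d Z1d def_x] := src_x.
have S1x j : x != rev (side t j).
  by have := side_x t j; rewrite setU11 rev_eq; apply.
have from_old y : src y \in [set src d | d in Z] -> y \notin T ->
    (forall s j, s \in S -> rev y != side s j) -> fconnect (turn Z1) y (rev d0).
  move=> src_y T'y side_y; have /iter_findex/(old _ _ src_y) :=
      swept_boundary sweptZ src_y side_y.
  by rewrite (negPf T'y).
have [Z_x|] := boolP (src x \in [set src d | d in Z]).
  apply: from_old => // [|s j S_s]; first by rewrite !inE !negb_or !S1x.
  by apply: side_x; rewrite in_setU1 S_s orbT.
move=> Z'x; apply: connect_trans (around x _ (S1x _)) _.
  move: Z1d Z'x; rewrite def_x.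
  rewrite !inE => /or4P[/eqP->|/eqP->|/eqP->|/orP[/eqP->|/swept_src->]] //;
    rewrite ?src3 ?src_rd4 //.
  by rewrite swept_src.
apply: from_old => // s j S_s; apply: contraNneq Z'd3 => def_s.
by rewrite -swept_revE def_s (swept_side sweptZ).
Qed.

Lemma corner_end : Z1 = setT -> corner E (src d4).
Proof.
move=> full; have at_new d : src d = src d4 -> d = rev d3 \/ d = d4.
  by apply: corner_at; rewrite full inE.
have def_b : cw E d4 = rev d3.
  have [//|def_d4] := at_new _ (cw_src d4).
  have : cw E (rev d3) = d4 by rewrite cw_rev_side Z4_addE.
  by rewrite -[RHS]def_d4 => /cw_inj/eqP; rewrite (negPf corner_rev34).
have no_side k : side t k \notin Z -> ~~ is_side (rev (side t k)).
  move=> Z'k; apply/negP=> /is_sideP[s [j def_s]].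
  (* With all edges swept, convexity applies to every square. A square of [S] has its sides in [Z],
     and two sides of [t] are never the same edge. *)
  have: s \in t |: S.
    by apply: (@corner_convex s j (rev (side s (j + 2%:R)))); rewrite ?full ?inE ?connect0.
  rewrite in_setU1 => /predU1P[eq_s|/(swept_side sweptZ j)]; last first.
    by rewrite -def_s swept_revE (negPf Z'k).
  rewrite {}eq_s in def_s; have : parallel (side t k) (side t j).
    by rewrite -def_s parallel_rev.
  case: (Z4_cases k j) def_s => -> def_s.
  - by have := rev_neq (side t k); rewrite def_s eqxx.
  - by rewrite (negPf (parallel_consecutive _ _)).
  - move=> _; have [] := cross_no_return (cross_side t k) (connect0 _ _).
    by rewrite -def_s revK eqxx.
  by rewrite (negPf (parallel_last _ _)).
exists (rev d4); rewrite revK def_b; split.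
- by rewrite side_closed Z4_addE.
- exact: no_side corner_d4.
- exact: no_side corner_d3.
by exists t, (i + 2%:R); rewrite !revK Z4_addE.
Qed.

End Corner.

(** * Existence of a growing step *)

Section Extension.
Hypothesis outer_d0 : ~~ is_side d0.
Hypothesis no_spur : forall z, z \notin Z -> src z \in [set src d | d in Z] ->
  exists2 e, e \in Z & parallel z e.
Hypothesis no_corner : forall t i, side t i \in Z -> side t (i + 1) \in Z -> t \in S.

(* The curve of [z] comes from [Z] and crosses [z] from its right to its left. *)
Definition leftward z := [/\ z \notin Z, src z \in [set src d | d in Z] &
  exists2 e, e \in Z & e ~> z].

(** The square [t] traversed just before [z] lies to its right, so [cw E z] is the next side of
    [t]. *)
Lemma leftward_square z : leftward z -> exists t j,
  [/\ z = rev (side t (j + 2%:R)), cw E z = side t (j + 3%:R) &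
      exists2 e, e \in Z & e ~> side t j].
Proof.
case=> Z'z _ [e Z_e e_z]; have [|d e_d] := cross_last e_z;
  first by apply: contraNneq Z'z => <-.
case/crossP=> t [j [def_d def_z]]; exists t, j; rewrite -def_d; split=> //;
  last by exists e.
by rewrite def_z cw_rev_side Z4_addE.
Qed.

(** The hyperplane of [cw E z] meets [Z]. Were it to cross from the other side, its ray and that of
    [z] would cross in the square between the two darts, against [no_opposed_rays]. *)
Lemma leftward_cw z : leftward z -> cw E z \notin Z -> leftward (cw E z).
Proof.
move=> left_z Z'cz; have [t [j [def_z def_cz [e Z_e e_t]]]] := leftward_square left_z.
have [Z'z src_z _] := left_z; have src_cz : src (cw E z) \in [set src d | d in Z] by rewrite cw_src.
have [e1 Z_e1 par_e1] := no_spur Z'cz src_cz.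
have [[e2 Z_e2 e2_cz]|[e2 Z_e2 e2_rcz]] := outer_covered Z_e1 par_e1.
  by split=> //; exists e2.
have [|d e2_d cr_d] := cross_last e2_rcz.
  by apply: contraNneq Z'cz => def_e2; rewrite -swept_revE -def_e2.
have def_d : d = side t (j + 1).
  by apply: cross_inj cr_d _; rewrite def_cz -Z4_add12; apply: cross_side.
rewrite {}def_d in e2_d; case: (no_opposed_rays Z_e Z_e2 e_t e2_d); rewrite -?def_cz //.
by move: Z'z; rewrite def_z swept_revE.
Qed.

(** If the next side of [t] is in [Z], the frontier follows it to the side of [t] opposite to [z],
    which the same ray crosses earlier. That side is not in [Z], as otherwise [no_corner] would put
    [t] in [S]. *)
Lemma leftward_opposite z : leftward z -> cw E z \in Z -> leftward (turn Z (rev (cw E z))).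
Proof.
move=> left_z Z_cz; have [t [j [def_z def_cz [e Z_e e_t]]]] := leftward_square left_z.
have [Z'z src_z _] := left_z.
have def_t : cw E (rev (cw E z)) = side t j by rewrite def_cz cw_rev_side Z4_addE.
have Z't : side t j \notin Z.
  apply: contra Z'z => Z_t; rewrite def_z swept_revE; apply: (swept_side sweptZ).
  by apply: (@no_corner t (j + 3%:R)); rewrite ?Z4_addE // -def_cz.
rewrite turn_out def_t //; split=> //; last by exists e.
by rewrite -def_t cw_src swept_tgt.
Qed.

Lemma leftward_absurd z : ~ leftward z.
Proof.
(* The second alternative is the position reached after following an edge of [Z], before turning at
   its end. *)
move=> left_z; pose left_of x := leftward x \/
  exists y, [/\ leftward y, cw E y \in Z & x = rev (cw E y)].
have left_turn n : left_of (iter n (turn Z) z).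
  elim: n => [|n]; [by left | rewrite iterS].
  case=> [left_x|[y [left_y Z_y ->]]]; last by left; apply: leftward_opposite.
  have [Z_x|Z'x] := boolP (cw E (iter n (turn Z) z) \in Z).
    by right; exists (iter n (turn Z) z); rewrite turn_in.
  by left; rewrite turn_out //; apply: leftward_cw.
have [Z'z src_z _] := left_z.
have /iter_findex def_d0 : fconnect (turn Z) z (rev d0).
  apply: (swept_boundary sweptZ) => // s i S_s.
  by apply: contraNneq Z'z => def_z; rewrite -swept_revE def_z (swept_side sweptZ).
have := left_turn (findex (turn Z) z (rev d0)).
rewrite def_d0 => -[[]|[y [left_y _ /(can_inj (@revK X))def_y]]].
  by rewrite swept_revE (swept_base sweptZ).
have [t [j [_ def_t _]]] := leftward_square left_y.
by case/negP: outer_d0; rewrite def_y def_t is_side_side.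
Qed.

Lemma outer_next d : ~~ is_side d -> ~~ is_side (cw E (rev d)).
Proof.
apply: contra => /is_sideP[s [i def_d]]; apply/is_sideP; exists s, (i + 3%:R).
apply: (can_inj (@revK X)); apply: (@cw_inj _ E).
by rewrite cw_rev_side Z4_addE.
Qed.

(** A ray reaching the next outer edge from [Z] would either be leftward or come out of a square
    that has this edge as a side. *)
Lemma outer_next_swept d : d \in Z -> ~~ is_side d -> cw E (rev d) \in Z.
Proof.
move=> Z_d out_d; apply/negPn/negP=> Z'cd.
have src_cd : src (cw E (rev d)) \in [set src d | d in Z] by rewrite cw_src swept_tgt.
have [e Z_e par_e] := no_spur Z'cd src_cd.
have [left_cd|[e1 Z_e1 e1_cd]] := outer_covered Z_e par_e.
  by apply: (@leftward_absurd (cw E (rev d))).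
have [|e2 _ /crossP[s [i [_ /(can_inj (@revK X))def_cd]]]] := cross_last e1_cd.
  by apply: contraNneq Z'cd => def_e1; rewrite -swept_revE -def_e1.
by have := outer_next out_d; rewrite def_cd is_side_side.
Qed.

(** The outer darts of [Z] are permuted by [next], so the frontier walk from [z], read backwards
    from its end at [d0], only follows such darts. This would force [rev z] into [Z]. *)
Lemma swept_closed z : src z \in [set src d | d in Z] -> z \in Z.
Proof.
move=> src_z; apply/negPn/negP=> Z'z.
pose N := [set d in Z | ~~ is_side d]; pose next d := cw E (rev d).
have next_inj : injective next by move=> d e /cw_inj/(can_inj (@revK X)).
have N_next : next @: N = N.
  apply/eqP; rewrite eqEcard card_imset // leqnn andbT; apply/subsetP=> _ /imsetP[d N_d ->].
  by move: N_d; rewrite !inE => /andP[Z_d out_d]; rewrite outer_next_swept ?outer_next.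
have back x : rev (turn Z x) \in N -> rev x \in N.
  have [Z_x|Z'x] := boolP (cw E x \in Z); last first.
    by rewrite turn_out // inE swept_revE (negPf Z'x).
  rewrite turn_in // revK -{1}N_next => /imsetP[d N_d /cw_inj->].
  by rewrite revK.
have /iter_findex def_d0 : fconnect (turn Z) z (rev d0).
  apply: (swept_boundary sweptZ) => // s i S_s.
  by apply: contraNneq Z'z => def_z; rewrite -swept_revE def_z (swept_side sweptZ).
have: rev (iter (findex (turn Z) z (rev d0)) (turn Z) z) \in N.
  by rewrite def_d0 revK inE (swept_base sweptZ).
elim: (findex _ _ _) => [|n IHn]; last by rewrite iterS => /back.
by rewrite inE swept_revE (negPf Z'z).
Qed.

Hypothesis Xconn : forall x y : vertex X, exists p, walk x y p.

Lemma swept_full : Z = setT.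
Proof.
apply/setP=> d; rewrite inE; apply: swept_closed.
have [p] := Xconn (src d0) (src d); have := swept_src (swept_base sweptZ).
elim: p (src d0) => [u src_u /eqP<- //|e p IHp u src_u /= /andP[/eqP def_u]].
by apply: IHp; apply: swept_tgt; apply: swept_closed; rewrite def_u.
Qed.

End Extension.

End Swept.

(** * The sweep from an outer edge *)

Section Sweep.
Variable d0 : dart X.
Hypothesis outer_d0 : ~~ is_side d0.
Hypothesis Xconn : forall x y : vertex X, exists p, walk x y p.
Hypothesis Xcross : forall H K : {set dart X},
  hyperplane H -> hyperplane K -> H <> K -> (crossings H K <= 2)%N.

Local Notation Z0 := [set d0; rev d0].

Lemma swept_edge : swept d0 Z0 set0.
Proof.
have Z0_d0 : d0 \in Z0 by rewrite set21.
have Z0_rd0 : rev d0 \in Z0 by rewrite set22.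
(* [loop_parallel] with an empty path: a loop edge would be parallel to no edge at all. *)
have noloop : src d0 != tgt d0.
  apply/eqP=> def_d0; have [|g] := @loop_parallel d0 [::]; last by rewrite in_nil.
  by rewrite /= def_d0.
have Z0rev d : d \in Z0 -> rev d \in Z0 by move=> /set2P[]->; rewrite ?revK.
split=> // [s i||s i d|x].
- by rewrite inE.
- apply: (swept_conn_from Z0rev) => d /set2P[]->; first by exists [::] => //=.
  by exists [:: d0]; [rewrite /= !eqxx|move=> g; rewrite inE => /eqP->].
- move=> Z_s s_d Z_d; have [neq1 neq2] := cross_no_return (cross_side s i) s_d.
  by case/set2P: Z_s neq1 neq2 => ->; case/set2P: Z_d => ->; rewrite ?revK eqxx.
have src_inj d r : d \in Z0 -> r \in Z0 -> src d = src r -> d = r.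
  move=> /set2P[]-> /set2P[]-> // /eqP; first by rewrite (negPf noloop).
  by rewrite eq_sym (negPf noloop).
have turn_to r : r \in Z0 -> src x = src r -> fconnect (turn Z0) x (rev r).
  by move=> Z_r src_x; apply: turn_around => // d Z_d /(src_inj d r Z_d Z_r)->;
    rewrite eqxx.
move=> /imsetP[d /set2P[]-> src_x _]; first exact: turn_to.
apply: connect_trans (turn_to _ Z0_rd0 src_x) _; rewrite revK.
by apply: turn_around => // d' Z_d' /(src_inj d' d0 Z_d' Z0_d0)->; rewrite eqxx.
Qed.

Lemma edge_end : Z0 = setT -> spur (src d0).
Proof.
move=> full; exists d0; split=> // [d _|s i _].
  by apply/set2P; rewrite full inE.
have is_d0 j : side s j = rev d0.
  have: side s j \in Z0 by rewrite full inE.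
  by case/set2P=> // def_d0; have := is_side_side s j; rewrite def_d0 (negPf outer_d0).
by have := parallel_consecutive s i; rewrite !is_d0 parallel_refl.
Qed.

(** Induction on the number of darts outside [Z]. A step that makes [Z] everything yields the spur
    or the corner; if no step is possible, [Z] was everything already. *)
Lemma sweep (Z : {set dart X}) (S : {set square X}) : swept d0 Z S -> Z <> setT ->
  (exists v, corner E v) \/ (exists v : vertex X, spur v).
Proof.
have [n] := ubnP #|~: Z|; elim: n Z S => // n IHn Z S /ltnSE-le_n sweptZ notfull.
have step (Z1 : {set dart X}) S1 d : d \notin Z -> d \in Z1 -> Z \subset Z1 ->
  swept d0 Z1 S1 -> Z1 <> setT ->
    (exists v, corner E v) \/ (exists v : vertex X, spur v).
  move=> Z'd Z1d sZZ1 sweptZ1; apply: IHn sweptZ1; apply: leq_trans le_n.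
  apply: proper_card; rewrite properEneq setCS sZZ1 andbT.
  by apply: contraNneq Z'd => /setC_inj <-.
have [|no_spur] := boolP [exists f, [&& f \notin Z, src f \in [set src d | d in Z] &
    [forall e, (e \in Z) ==> ~~ parallel f e]]].
  case/existsP=> f /and3P[Z'f src_f /forallP f_missed0].
  have f_missed e : e \in Z -> ~~ parallel f e by move: (f_missed0 e) => /implyP.
  have [full|/eqP notfull1] := eqVneq (f |: (rev f |: Z)) setT.
    by right; exists (tgt f); apply: (spur_end sweptZ) full.
  apply: (step (f |: (rev f |: Z)) S f) => //; first by rewrite setU11.
    by rewrite setUA subsetUr.
  exact: swept_spur.
have [|no_corner] := boolP [exists t, exists i,
    [&& t \notin S, side t i \in Z & side t (i + 1) \in Z]].
  case/existsP=> t /existsP[i /and3P[S't Z_d1 Z_d2]].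
  set Z1 := side t (i + 2%:R) |: (rev (side t (i + 2%:R)) |:
    (side t (i + 3%:R) |: (rev (side t (i + 3%:R)) |: Z))).
  have [full|/eqP notfull1] := eqVneq Z1 setT.
    by left; exists (src (side t (i + 3%:R))); apply: (corner_end sweptZ) full.
  apply: (step Z1 (t |: S) (side t (i + 2%:R))) => //; last exact: swept_corner.
  - exact: (corner_d3 sweptZ).
  - by rewrite setU11.
  by rewrite /Z1 !setUA subsetUr.
case: notfull; apply: (swept_full sweptZ) Xconn => // [z Z'z src_z|t i Z_d1 Z_d2].
  move: no_spur; rewrite negb_exists => /forallP/(_ z); rewrite Z'z src_z /= negb_forall.
  by case/existsP=> e; rewrite negb_imply negbK => /andP[]; exists e.
apply: contraNT no_corner => S't; apply/existsP; exists t; apply/existsP; exists i.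
by rewrite S't Z_d1.
Qed.

End Sweep.
End SimpleArcs.
End Cross.

Theorem theorem1p6 (X : squareComplex) (E : planeEmbedding X)
    (Xdisk : homotopic_to_disk X)
    (Xarcs : forall H : {set dart X}, hyperplane H -> simple_arc H)
    (Xcross : forall H K : {set dart X},
        hyperplane H -> hyperplane K -> H <> K -> crossings H K <= 2)
    (Xnontrivial : ~ single_vertex X) :
  (exists v : vertex X, corner E v) \/ (exists v : vertex X, spur v).
Proof.
case: Xdisk => [[[x _] Xconn] Xsimple _].
have [/existsP[d _]|no_dart] := boolP [exists d : dart X, true].
  have [d0 _ outer_d0] := unbounded E d.
  have [full|/eqP notfull] := eqVneq [set d0; rev d0] setT.
    by right; exists (src d0); apply: edge_end full.
  exact: sweep (swept_edge _ _ _ _) notfull.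
(* Without edges there are no squares, and connectedness leaves a single vertex. *)
have noD (d : dart X) : False.
  by move: no_dart; rewrite negb_exists => /forallP/(_ d).
case: Xnontrivial; split.
- apply/eqP; rewrite -cardsT; apply/cards1P; exists x; apply/setP=> y; rewrite !inE.
  by have [[/eqP->|d]] := Xconn x y; [rewrite eqxx|case: (noD d)].
- by apply/eqP/pred0P => d; case: (noD d).
by apply/eqP/pred0P => s; case: (noD (side s 0%R)).
Qed.
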